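(* Let $\mathbf X$ and $\mathbf Y$ be disjoint node sets in an MPDAG $\mathcal G=(\mathbf V,\mathbf E)$. If there is a proper possibly causal path from $\mathbf X$ to $\mathbf Y$ that starts with an undirected edge in $\mathcal G$, then the causal effect of $\mathbf X$ on $\mathbf Y$ is not identifiable in $\mathcal G$.
   Context: Graphs. A graph $\mathcal G=(\mathbf V,\mathbf E)$ has a finite node set $\mathbf V$ and edges that are directed ($\to$) or undirected ($-$), at most one edge between any two nodes. A path is a sequence of distinct nodes with successive nodes adjacent. A causal path from $X$ to $Y$ is a path all of whose edges point towards $Y$. A path $\langle V_0,\dots,V_k\rangle$, $k\ge1$, is possibly causal if there is no edge $V_i\leftarrow V_j$ in $\mathcal G$ for any $0\le i<j\le k$. A path from a set $\mathbf X$ to a set $\mathbf Y$ is a path from some $X\in\mathbf X$ to some $Y\in\mathbf Y$; it is proper (w.r.t. $\mathbf X$) if only its first node is in $\mathbf X$. A directed cycle is a causal path from $X$ to $Y$ together with $Y\to X$. A PDAG is a graph with directed and undirected edges and no directed cycle; a DAG is a PDAG with only directed edges. $\mathrm{Pa}(V,\mathcal D)$ is the set of parents of $V$ in $\mathcal D$. MPDAGs. An unshielded collider is $A\to B\leftarrow C$ with $A,C$ nonadjacent. A DAG $\mathcal D$ is represented by $\mathcal G$ if it has the same adjacencies and the same unshielded colliders as $\mathcal G$ and every directed edge $X\to Y$ of $\mathcal G$ is in $\mathcal D$; $[\mathcal G]$ is the set of all such DAGs. An MPDAG (maximally oriented PDAG) is a PDAG $\mathcal G$ with $[\mathcal G]\neq\emptyset$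 having none of the following as an induced subgraph: (a) $K\to I$, $I-J$, with $K,J$ nonadjacent; (b) $I\to K\to J$, $I-J$; (c) $K\to J$, $L\to J$, $I-J$, $I-K$, $I-L$, with $K,L$ nonadjacent; (d) $J\to L$, $L\to K$, $I-K$, $I-J$, $I-L$, with $J,K$ nonadjacent. Densities. Nodes also denote random variables (real-valued, say); a density $f$ of $\mathbf V$ is an observational density consistent with a DAG $\mathcal D=(\mathbf V,\mathbf E)$ if $f(\mathbf v)=\prod_{V_i\in\mathbf V}f(v_i\mid \mathrm{pa}(v_i,\mathcal D))$; it is consistent with an MPDAG $\mathcal G$ if it is consistent with some DAG in $[\mathcal G]$. Given $f$ consistent with $\mathcal D$, $\mathbf X\subset\mathbf V$ and $\mathbf V'=\mathbf V\setminus\mathbf X$, the interventional density consistent with $\mathcal D$ is $f(\mathbf v'\mid do(\mathbf x))=\prod_{V_i\in\mathbf V'}f(v_i\mid\mathrm{pa}(v_i,\mathcal D))$ for values $\mathrm{pa}(v_i,\mathcal D)$ of $\mathrm{Pa}(V_i,\mathcal D)$ in agreement with $\mathbf x$; for $\mathbf Y\subseteq\mathbf V'$, $f(\mathbf y\mid do(\mathbf x))$ is its marginal density of $\mathbf Y$. Identifiability. The causal effect of $\mathbf X$ on $\mathbf Y$ is identifiable in $\mathcal G$ if $f(\mathbf y\mid do(\mathbf x))$ is uniquely computable from any observational density consistent with $\mathcal G$; that is, there are no two DAGs $\mathcal D^1,\mathcal D^2$ in $[\mathcal G]$ such that (1) $f_1(\mathbf v)=f_2(\mathbf v)=f(\mathbf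 v)$ for an observational density $f$ consistent with $\mathcal G$, and (2) $f_1(\mathbf y\mid do(\mathbf x))\neq f_2(\mathbf y\mid do(\mathbf x))$, where $f_1(\cdot\mid do(\mathbf x))$ and $f_2(\cdot\mid do(\mathbf x))$ are the interventional densities consistent with $\mathcal D^1$ and $\mathcal D^2$ (formed from $f_1$ and $f_2$) respectively. *)

(* Defs.v *)
From HB Require Import structures.
From mathcomp Require Import all_boot all_order all_algebra.
From mathcomp Require Import all_classical all_reals all_analysis.

Set Implicit Arguments.
Unset Strict Implicit.
Unset Printing Implicit Defensive.

Import Order.TTheory GRing.Theory Num.Theory.
Import numFieldNormedType.Exports.

Local Open Scope classical_set_scope.
Local Open Scope ring_scope.

(* Graphs with directed and undirected edges, at most one edge between any two
   nodes and no self-loops. *)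
Record graph (V : finType) := Graph {
  dir : rel V;   (* dir x y : x -> y *)
  und : rel V;   (* und x y : x - y *)
  _ : irreflexive dir;
  _ : irreflexive und;
  _ : symmetric und;
  _ : forall x y, dir x y -> ~~ dir y x;
  _ : forall x y, dir x y -> ~~ und x y
}.

Section Graphs.
Context {V : finType}.
Implicit Types (G D : graph V) (X Y : {set V}) (x y a b c i j k l : V)
  (p : seq V).

Definition adj G x y : bool := [|| dir G x y, dir G y x | und G x y].

Definition parents G x : {set V} := [set y | dir G y x].

(* The path <V_0, ..., V_k> is split into its first node x = V_0 and the
   sequence p = V_1, ..., V_k. *)
Definition is_path G x p : bool := uniq (x :: p) && path (adj G) x p.

Definition causal_path G x p : bool := is_path G x p && path (dir G) x p.

(* [pairwise] ranges over all pairs of positions i < j, so this forbids every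
   edge V_i <- V_j, not only those between successive nodes. *)
Definition possibly_causal_path G x p : bool :=
  [&& is_path G x p, p != [::] & pairwise (fun a b => ~~ dir G b a) (x :: p)].

Definition path_from_to X Y x p : bool := (x \in X) && (last x p \in Y).

Definition proper_path X p : bool := all (fun z => z \notin X) p.

Definition has_directed_cycle G : Prop :=
  exists x p, causal_path G x p /\ dir G (last x p) x.

Definition is_pdag G : Prop := ~ has_directed_cycle G.

Definition is_dag G : Prop := is_pdag G /\ forall x y, ~~ und G x y.

Definition unshielded_collider G a b c : bool :=
  [&& dir G a b, dir G c b, a != c & ~~ adj G a c].

Definition represented G D : Prop :=
  [/\ is_dag D,
      forall x y, adj D x y = adj G x y,
      forall a b c, unshielded_collider D a b c = unshielded_collider G a b c
    & forall x y, dir G x y -> dir D x y].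

(* The four forbidden induced subgraphs.  In (c) the distinctness of k and l
   has to be required; all other distinctness conditions follow from there
   being at most one edge between two nodes. *)
Definition forbidden_a G k i j : bool :=
  [&& dir G k i, und G i j & ~~ adj G k j].

Definition forbidden_b G i j k : bool :=
  [&& dir G i k, dir G k j & und G i j].

Definition forbidden_c G i j k l : bool :=
  [&& dir G k j, dir G l j, und G i j, und G i k, und G i l, k != l
    & ~~ adj G k l].

Definition forbidden_d G i j k l : bool :=
  [&& dir G j l, dir G l k, und G i k, und G i j, und G i l & ~~ adj G j k].

Definition is_mpdag G : Prop :=
  [/\ is_pdag G,
      exists D, represented G D,
      forall i j k, ~~ forbidden_a G k i j /\ ~~ forbidden_b G i j k
    & forall i j k l, ~~ forbidden_c G i j k l /\ ~~ forbidden_d G i j k l].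

End Graphs.

Section Densities.
Context (R : realType) {V : finType}.
Implicit Types (v : V -> R) (f : (V -> R) -> R) (h : (V -> R) -> \bar R).
Implicit Types (W S X Y : {set V}) (i : V) (G D : graph V).

Definition cylinders : set (set (V -> R)) :=
  [set A | exists i (B : set R), measurable B /\ A = [set v | B (v i)]].

(* The space R^V with its product sigma-algebra. *)
Definition assignment := g_sigma_algebraType cylinders.

Definition upd v i (t : R) : V -> R := fun j => if j == i then t else v j.

(* Integral of h over the coordinates in W, the other coordinates being those
   of v: an iterated Lebesgue integral.  By Tonelli the order of integration
   does not matter for the nonnegative measurable h used below. *)
Definition integral_over W h : (V -> R) -> \bar R :=
  foldr (fun i g v => (\int[@lebesgue_measure R]_t g (upd v i t))%E)
    h (enum W).

(* Null sets of the Lebesgue measure on R^V.  A set that constrains only the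
   coordinates in some W is null here iff it is null in R^W. *)
Definition lebesgue_null (N : set (V -> R)) : Prop :=
  exists A : set assignment,
    [/\ measurable A,
        forall v, integral_over [set: V] (fun u => (\1_A u)%:E) v = 0%E
      & N `<=` A].

Definition is_density f : Prop :=
  [/\ measurable_fun [set: assignment] f,
      forall v, 0 <= f v
    & forall v, integral_over [set: V] (fun u => (f u)%:E) v = 1%E].

(* f(v_S); it depends only on the coordinates of v in S. *)
Definition marginal f S v : R :=
  fine (integral_over (~: S) (fun u => (f u)%:E) v).

(* f(v_i | v_S) for i not in S; it is 0 when f(v_S) = 0. *)
Definition conditional f i S v : R := marginal f (i |: S) v / marginal f S v.

(* Densities are determined up to null sets, hence so is the factorization. *)
Definition consistent_dag D f : Prop :=
  is_density f /\
  lebesgue_null [set v | f v <> \prod_i conditional f i (parents D i) v].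

Definition consistent_mpdag G f : Prop :=
  exists2 D, represented G D & consistent_dag D f.

(* f(v' | do(x)) formed from f and D, where x and v' are the coordinates of v
   in X and outside X. *)
Definition do_density D f X v : R :=
  \prod_(i | i \notin X) conditional f i (parents D i) v.

(* f(y | do(x)) : the coordinates outside X and Y are integrated out. *)
Definition do_marginal D f X Y v : \bar R :=
  integral_over (~: (X :|: Y)) (fun u => (do_density D f X u)%:E) v.

(* Nonnegative densities f may vanish.  The truncated factorization at x
   involves undefined conditional densities (those given an event of density 0)
   on a set it charges exactly when, with the convention above, its total mass
   is less than 1.  At such x the density f(v' | do(x)) is undefined. *)
Definition do_defined D f X v : Prop :=
  integral_over (~: X) (fun u => (do_density D f X u)%:E) v = 1%E.

(* Two interventional densities f_1(y | do(x)) and f_2(y | do(x)) differ when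
   they do so, where both are defined, on a non-null set of values (x, y). *)
Definition do_marginals_differ D1 D2 f1 f2 X Y : Prop :=
  ~ lebesgue_null [set v | [/\ do_defined D1 f1 X v, do_defined D2 f2 X v
      & do_marginal D1 f1 X Y v <> do_marginal D2 f2 X Y v]].

Definition identifiable G X Y : Prop :=
  ~ exists D1 D2 f f1 f2,
    [/\ represented G D1, represented G D2,
        [/\ consistent_dag D1 f1, consistent_dag D2 f2
          & consistent_mpdag G f],
        f1 = f /\ f2 = f
      & do_marginals_differ D1 D2 f1 f2 X Y].

End Densities.

(* Main.v *)
Require Import Defs.
From mathcomp Require Import all_boot all_order all_algebra.
From mathcomp Require Import all_classical all_reals all_analysis.
From mathcomp Require Import measurable_realfun ring lra.

(* Completeness of the four orientation rules: the DAGs of [G] correspond to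
   elimination orders, in which each node is a potential sink of what remains.
   In an MPDAG every ordering of a clique that respects the directed edges
   extends to an elimination order, by induction on the number of nodes; for a
   clique of size two, this orients any undirected edge either way.

   On the given path let x - z be the last undirected edge of G from x to the
   path, and shorten the part from z to Y to a chordless path U. The remaining
   edges of G between x and U then leave x. Choose D1, D2 in [G] with x -> z in
   D1 and z -> x in D2. Since U has no unshielded collider, in each D_i it has
   exactly one node r_i without parents in U; moreover x -> r_1 in D1, while x is
   not a parent of r_2 in D2.

   Take a uniform hidden bit s. All nodes of U show s, x shows s with probability
   3/4 and 1 - s otherwise, and all other nodes are independent of s. The
   resulting density is a mixture of two product densities, so its marginals are
   explicit, and it is consistent with both D1 and D2. Under do(x) the bit shown
   by U agrees with the bit shown by x with probability 3/4 according to D1, but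
   1/2 according to D2. *)

Set Implicit Arguments.
Unset Strict Implicit.
Unset Printing Implicit Defensive.

(** * Completeness of the orientation rules *)

Section EliminationOrders.
Context {V : finType}.
Implicit Types (G D : graph V) (a b i j k l w x y z : V) (s t c : seq V).

Lemma dir_irr G x : dir G x x = false.
Proof. by case: G => d u hd ? ? ? ? /=; exact: hd. Qed.

Lemma und_irr G x : und G x x = false.
Proof. by case: G => d u ? hu ? ? ? /=; exact: hu. Qed.

Lemma und_sym G x y : und G x y = und G y x.
Proof. by case: G => d u ? ? us ? ? /=; exact: us. Qed.

Lemma dir_asym G x y : dir G x y -> dir G y x = false.
Proof. by case: G => d u ? ? ? da ? /= /da /negbTE. Qed.

Lemma dir_not_und G x y : dir G x y -> und G x y = false.
Proof. by case: G => d u ? ? ? ? du /= /du /negbTE. Qed.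

Lemma adj_sym G x y : adj G x y = adj G y x.
Proof. by rewrite /adj und_sym orbCA. Qed.

Lemma adj_irr G x : adj G x x = false.
Proof. by rewrite /adj dir_irr und_irr. Qed.

Lemma dir_adj G x y : dir G x y -> adj G x y.
Proof. by rewrite /adj => ->. Qed.

Lemma dir_adjr G x y : dir G x y -> adj G y x.
Proof. by rewrite /adj => ->; rewrite orbT. Qed.

Lemma und_adj G x y : und G x y -> adj G x y.
Proof. by rewrite /adj => ->; rewrite !orbT. Qed.

Section Rules.
Variable G : graph V.
Hypothesis mG : is_mpdag G.

Lemma rule_a k i j : dir G k i -> und G i j -> adj G k j.
Proof.
move=> h1 h2; case: mG => _ _ h _; have [+ _] := h i j k.
by rewrite /forbidden_a h1 h2 /= negbK.
Qed.

Lemma rule_b i k j : dir G i k -> dir G k j -> und G i j = false.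
Proof.
move=> h1 h2; case: mG => _ _ h _; have [_ +] := h i j k.
by rewrite /forbidden_b h1 h2 /= => /negbTE.
Qed.

Lemma rule_c i j k l : dir G k j -> dir G l j -> und G i j -> und G i k ->
  und G i l -> k != l -> adj G k l.
Proof.
move=> h1 h2 h3 h4 h5 h6; case: mG => _ _ _ h; have [+ _] := h i j k l.
by rewrite /forbidden_c h1 h2 h3 h4 h5 h6 /= negbK.
Qed.

Lemma rule_d i j k l : dir G j l -> dir G l k -> und G i k -> und G i j ->
  und G i l -> adj G j k.
Proof.
move=> h1 h2 h3 h4 h5; case: mG => _ _ _ h; have [_ +] := h i j k l.
by rewrite /forbidden_d h1 h2 h3 h4 h5 /= negbK.
Qed.

End Rules.

(** When all edges between [x] and [s] are made to point at [x], these two conditions keep the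
    directed edges of [G] and prevent new unshielded colliders at [x]. *)
Definition potential_sink G x s : Prop := forall y, y \in s ->
  ~~ dir G x y /\
  (und G x y -> forall z, z \in s -> adj G x z -> y != z -> adj G y z).

(* The list runs backwards in time: its head is the last node of the DAG. *)
Fixpoint elim_order G s : Prop :=
  if s is x :: s' then potential_sink G x s' /\ elim_order G s' else True.

Lemma potential_sink_sub G x s t :
  {subset t <= s} -> potential_sink G x s -> potential_sink G x t.
Proof.
move=> ts h y /ts /h [h1 h2]; split=> // u z /ts; exact: h2.
Qed.

Lemma elim_order_filter G (P : pred V) s :
  elim_order G s -> elim_order G [seq x <- s | P x].
Proof.
elim: s => //= x s IH [sx es]; case: ifP => [_|_]; last exact: IH.
split; last exact: IH.
by apply: potential_sink_sub sx => y; rewrite mem_filter => /andP[].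
Qed.

Lemma elim_order_index G s x y : elim_order G s -> uniq s ->
  x \in s -> y \in s -> index x s < index y s ->
  ~~ dir G x y /\ (und G x y -> forall z, z \in s -> index x s < index z s ->
    adj G x z -> y != z -> adj G y z).
Proof.
elim: s => //= a s IH [sa es] /andP[as_ us].
rewrite !inE eq_sym => xs; rewrite eq_sym => ys.
case: (a =P x) xs => [ax _|_ /= xs].
  subst x; case: eqP ys => // _ /= ys _.
  have [h1 h2] := sa y ys; split=> // u z.
  by rewrite inE eq_sym; case: eqP => //= _ zs _; exact: h2.
case: eqP ys => // _ /= ys; rewrite ltnS => xy.
have [h1 h2] := IH es us xs ys xy; split=> // u z.
by rewrite inE [z == _]eq_sym; case: eqP => //= _ zs; rewrite ltnS; exact: h2.
Qed.

Lemma elim_order_dir G s x y : elim_order G s -> uniq s ->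
  x \in s -> y \in s -> dir G x y -> index y s < index x s.
Proof.
move=> es us xs ys dxy; rewrite ltnNge leq_eqVlt; apply/negP => /orP[/eqP e|lt].
  have exy : x = y by rewrite -(nth_index x xs) e nth_index.
  by rewrite exy dir_irr in dxy.
by have [] := elim_order_index es us xs ys lt; rewrite dxy.
Qed.

Lemma elim_order_pairwise G s :
  elim_order G s -> pairwise (fun x y => ~~ dir G x y) s.
Proof.
elim: s => //= x s IH [sx /IH->]; rewrite andbT.
by apply/allP => y /sx [].
Qed.

Lemma subseq_index c s x y : uniq s -> subseq (x :: c) s -> y \in c ->
  index x s < index y s.
Proof.
move=> us sub yc.
suff /(subseq_pairwise sub) /= /andP[/allP h _] :
  pairwise (fun x y => index x s < index y s) s by exact: h.
by apply/(pairwiseP x) => i j; rewrite !inE => ? ? ?; rewrite !index_uniq.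
Qed.

(* Suppose that the last node [a] is in the clique. Let [b] be the last one of
   [k] and the undirected neighbours of [a] that are children of [k]. If all
   neighbours of [b] are neighbours of [a], then [b] can be last. Otherwise some
   neighbour [w] of [b] is not adjacent to [a], and the other nodes can be
   reordered such that [b] follows the other neighbours of [a] and [w] follows
   [b]; then the last of them is not adjacent to [a] and can be exchanged with
   it. *)
Lemma clique_sink G k c a s : is_mpdag G ->
  (forall s' c', size s' <= size s -> uniq s' -> elim_order G s' -> uniq c' ->
    {subset c' <= s'} -> {in c' &, forall x y, x != y -> adj G x y} ->
    pairwise (fun x y => ~~ dir G x y) c' ->
    exists t, [/\ perm_eq t s', elim_order G t & subseq c' t]) ->
  uniq (a :: s) -> elim_order G (a :: s) -> uniq (k :: c) ->
  {subset k :: c <= a :: s} -> {in k :: c &, forall x y, x != y -> adj G x y} ->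
  pairwise (fun x y => ~~ dir G x y) (k :: c) ->
  exists x t, [/\ perm_eq (x :: t) (a :: s), elim_order G (x :: t) & x \notin c].
Proof.
move=> mG IH /= /andP[as0 us0] [sa es0] /andP[kc uc] sub cl /andP[kdir pw].
have [ac|ac] := boolP (a \in c); last by exists a, s.
have ak : a != k by apply: contraNneq kc => <-.
have ks0 : k \in s.
  by have := sub k (mem_head _ _); rewrite inE eq_sym (negbTE ak).
have uak : und G a k.
  have := cl a k; rewrite !inE ac eqxx orbT => /(_ isT isT ak).
  rewrite /adj (negbTE (allP kdir a ac)).
  by have [/negbTE-> _] := sa k ks0.
have nda y : y \in s -> dir G a y = false by move=> /sa [/negbTE].
have nd y z : y \in s -> z \in s -> und G a y -> adj G a z -> y != z ->
    adj G y z.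
  by move=> ys zs uy az yz; have [_] := sa y ys; exact.
(* A smallest index in [s] means last in time, so no undirected neighbour of [a] that is a child of
   [k] can be a child of the chosen [b]. *)
pose B := [pred x | [&& x \in s, und G a x & (x == k) || dir G k x]].
have Bk : B k by rewrite /= ks0 uak eqxx.
case: (arg_minnP (fun x => index x s) Bk) => b /and3P[bs0 uab kb] bmin.
have uba : und G b a by rewrite und_sym.
have ab : a != b by apply: contraTneq uab => ->; rewrite und_irr.
have bc : b \notin c.
  case/orP: kb => [/eqP->//|kb].
  by apply/negP => bc; have := allP kdir _ bc; rewrite /= kb.
have ix y z : y \in s -> z \in s -> dir G y z -> index z s < index y s.
  exact: elim_order_dir.
(* If [y -> a], then [b -> y -> a] with [b - a] violates rule (b). If [a - y], then [k -> y] by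
   acyclicity and rule (b), so [y] would be a later candidate than [b]. *)
have bdir y : y \in s -> adj G a y -> dir G b y = false.
  move=> ys ay; apply/negP => bdy.
  case/or3P: (ay) => [|ya|uay]; first by rewrite nda.
    by have := rule_b mG bdy ya; rewrite uba.
  have ky : dir G k y.
    case/orP: kb => [/eqP <-//|kb].
    have yk : k != y.
      by apply: contraTneq bdy => <-; rewrite (dir_asym kb).
    case/or3P: (nd _ _ ks0 ys uak ay yk) => // [yk'|ukx].
      have := ltn_trans (ix _ _ ys ks0 yk') (ix _ _ bs0 ys bdy).
      by move/ltn_trans/(_ (ix _ _ ks0 bs0 kb)); rewrite ltnn.
    by have := rule_b mG kb bdy; rewrite ukx.
  have := bmin y; rewrite /= ys uay ky orbT => /(_ isT).
  by rewrite leqNgt ix.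
have [/hasP[w ws0 /andP[naw abw]]|noW] :=
    boolP (has (fun w => ~~ adj G a w && adj G b w) s); last first.
  have N z : z \in s -> adj G b z -> adj G a z.
    move=> zs bz; apply: contraNT noW => az.
    by apply/hasP; exists z => //; rewrite az.
  exists b, (a :: rem b s); split=> //.
    rewrite -[b :: a :: _]/([:: b] ++ [:: a] ++ _) perm_catCA /= perm_cons.
    by rewrite perm_sym; exact: perm_to_rem.
  split; last first.
    split; first by apply: potential_sink_sub sa; exact: mem_rem.
    by rewrite rem_filter //; exact: elim_order_filter.
  move=> y yt; split.
    apply/negP => by_; move: yt; rewrite inE => /orP[/eqP ya|/mem_rem ys].
      by have := dir_not_und by_; rewrite ya uba.
    by have := bdir y ys (N _ ys (dir_adj by_)); rewrite by_.
  move=> uby z zt bz yz.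
  move: yt zt; rewrite !inE => /orP[/eqP ya|/mem_rem ys] /orP[/eqP za|/mem_rem zs].
  - by rewrite ya za eqxx in yz.
  - by rewrite ya; exact: N.
  - by rewrite za adj_sym N // und_adj.
  have ay := N _ ys (und_adj uby); have az := N _ zs bz.
  case/or3P: (ay) => [|ya|uay]; first by rewrite nda.
    case/or3P: (az) => [|za|uaz]; first by rewrite nda.
      case/or3P: bz => [bz|zb|ubz]; first by rewrite bdir in bz.
        by rewrite adj_sym; exact: (rule_a mG zb uby).
      exact: (rule_c mG ya za uba uby ubz).
    by rewrite adj_sym nd // eq_sym.
  exact: nd.
have nwb : dir G w b = false.
  by apply/negP => /(rule_a mG) /(_ uba); rewrite adj_sym (negbTE naw).
have wb : w != b by apply: contraTneq abw => ->; rewrite adj_irr.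
(* The neighbours of [a] in [s] other than [b], except the common parents of [a] and [b]: those
   precede [b] in time under any elimination order. *)
pose M := [seq m <- s | (m != b) && (und G a m || dir G m a && und G b m)].
have MP m : m \in M ->
    [/\ m \in s, m != b, adj G a m, adj G b m & und G a m \/
        dir G m a /\ und G b m].
  rewrite mem_filter -andbA => /and3P[mb h ms].
  have am : adj G a m.
    by case/orP: h => [/und_adj//|/andP[/dir_adjr]].
  split=> //; first by apply: nd => //; rewrite eq_sym.
  by case/orP: h => [|/andP[]]; [left|right].
have Mcl : {in b :: M &, forall x y, x != y -> adj G x y}.
  move=> x y; rewrite !inE => /orP[/eqP->|xM] /orP[/eqP->|yM].
  - by rewrite eqxx.
  - by move=> _; have [] := MP _ yM.
  - by move=> _; rewrite adj_sym; have [] := MP _ xM.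
  have [xs xb ax bx [ux|[xa ubx]]] := MP _ xM;
    have [ys yb ay by_ [uy|[ya uby]]] := MP _ yM => xy; try exact: nd.
    by rewrite adj_sym nd // eq_sym.
  exact: (rule_c mG xa ya uba ubx uby).
have Mpw : pairwise (fun x y => ~~ dir G x y) (b :: M).
  rewrite /=; apply/andP; split.
    by apply/allP => m /MP[ms _ am _ _]; rewrite bdir.
  by apply: subseq_pairwise (elim_order_pairwise es0); exact: filter_subseq.
have bM : b \notin M by rewrite mem_filter eqxx.
have uM : uniq (b :: M) by rewrite /= bM filter_uniq.
have Msub : {subset b :: M <= s}.
  by move=> x; rewrite inE => /orP[/eqP->//|/MP[]].
have [t0 [pt et bt wt]] : exists t0, [/\ perm_eq t0 s, elim_order G t0,
    (forall m, m \in M -> index b t0 < index m t0) &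
    index w t0 < index b t0].
  (* Here it suffices to put [b] after [M] in time. If [w] came before [b], then [b -> w] would be
     violated, or [b] as a sink with [b - w] would force [w] to be adjacent to every node of [M]. *)
  have [h|] := boolP (dir G b w || has (fun m => ~~ adj G m w) M).
    have [t0 [pt et st]] := IH s _ (leqnn _) us0 es0 uM Msub Mcl Mpw.
    have ut : uniq t0 by rewrite (perm_uniq pt).
    have bt m : m \in M -> index b t0 < index m t0.
      by move=> mM; exact: subseq_index mM.
    have bt0 : b \in t0 by rewrite (perm_mem pt).
    have wt0 : w \in t0 by rewrite (perm_mem pt).
    exists t0; split=> //.
    have [//|] := boolP (index w t0 < index b t0).
    case/orP: h => [h|/hasP[m mM nmw]]; first by rewrite (elim_order_dir et).
    rewrite -leqNgt leq_eqVlt => /orP[/eqP e|lt].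
      by move: wb; rewrite -(nth_index b wt0) -e nth_index // eqxx.
    have [ms mb am bm _] := MP _ mM.
    have [nbw h] := elim_order_index et ut bt0 wt0 lt.
    move: abw; rewrite /adj nwb (negbTE nbw) /= => /h /(_ m).
    rewrite (perm_mem pt) ms bm bt // => /(_ isT isT isT).
    rewrite adj_sym (negbTE nmw) => wm; apply: wm.
    by apply: contraNneq naw => ->.
  (* Now [w :: b :: M] is a clique; an edge from [w] into [M] would make [w] adjacent to [a] by rule
     (a) or (d), so this clique can be prescribed as a whole. *)
  rewrite negb_or => /andP[nbw /hasPn Mw].
  have ubw : und G b w by move: abw; rewrite /adj nwb (negbTE nbw).
  have nwM m : m \in M -> dir G w m = false.
    move=> mM; apply/negP => wm; case: (MP _ mM) => _ _ _ _ [uam|[ma ubm]].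
      have := rule_a mG wm (etrans (und_sym G m a) uam).
      by rewrite adj_sym (negbTE naw).
    by have := rule_d mG wm ma uba ubw ubm; rewrite adj_sym (negbTE naw).
  have wbM : w \notin b :: M.
    rewrite inE (negbTE wb) /=; apply/negP => /MP[_ _ aw _ _].
    by rewrite aw in naw.
  have [] := IH s (w :: b :: M) (leqnn _) us0 es0 _ _ _ _.
  - by rewrite /= in uM *; rewrite wbM uM.
  - by move=> x; rewrite inE => /orP[/eqP->//|/Msub].
  - move=> x y; rewrite !(in_cons w) => /orP[/eqP->|xM] /orP[/eqP->|yM].
    + by rewrite eqxx.
    + move=> _; move: yM; rewrite inE => /orP[/eqP->|/Mw].
        by rewrite adj_sym.
      by rewrite negbK adj_sym.
    + move=> _; move: xM; rewrite inE => /orP[/eqP->//|/Mw].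
      by rewrite negbK.
    + exact: Mcl.
  - rewrite /= in Mpw *; rewrite Mpw nwb /= andbT.
    by apply/allP => m /nwM ->.
  move=> t0 [pt et st]; have ut : uniq t0 by rewrite (perm_uniq pt).
  have st' := subseq_trans (subseq_cons (b :: M) w) st.
  exists t0; split=> //; last by apply: subseq_index st _ => //; exact: mem_head.
  by move=> m mM; exact: subseq_index mM.
case: t0 pt et bt wt => [|x t1] pt et bt wt; first by rewrite ltn0 in wt.
have xs : x \in s by rewrite -(perm_mem pt) mem_head.
have bx : b != x.
  by apply: contraTneq wt => ->; rewrite /= eqxx.
(* A neighbour of [a] is in [M], hence before [b] in time, or is a common parent of [a] and [b],
   hence before [b] as well; the last node [x] is neither. *)
have nax : ~~ adj G a x.
  apply/negP => ax.
  have xM : x \notin M by apply/negP => /bt; rewrite /= eqxx.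
  have := xM; rewrite mem_filter xs andbT eq_sym bx /= negb_or => /andP[nu].
  case/or3P: (ax) => [|xa|uax]; first by rewrite nda.
    rewrite xa /= => nub.
    case/or3P: (nd _ _ bs0 xs uab ax bx) => [|xb|]; first by rewrite bdir.
      have := elim_order_dir et _ (mem_head _ _) _ xb.
      rewrite (perm_uniq pt) (perm_mem pt) => /(_ us0 bs0).
      by rewrite /= eqxx.
    by rewrite (negbTE nub).
  by rewrite uax in nu.
exists x, (a :: t1); split.
- by rewrite -[x :: a :: _]/([:: x] ++ [:: a] ++ _) perm_catCA /= perm_cons.
- case: et => sx et; split; last first.
    split=> //; apply: potential_sink_sub sa => y yt.
    by rewrite -(perm_mem pt) inE yt orbT.
  have nxa : adj G x a = false by rewrite adj_sym (negbTE nax).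
  move=> y; rewrite inE => /orP[/eqP->|yt].
    split; first by apply: contraFN nxa => /dir_adj.
    by move/und_adj; rewrite nxa.
  have [h1 h2] := sx y yt; split=> // u z.
  rewrite inE => /orP[/eqP->|]; first by rewrite nxa.
  exact: h2.
- apply/negP => xc; move: nax; rewrite cl ?inE ?ac ?xc ?orbT //.
  by apply: contraNneq as0 => ->.
Qed.

(** Induction on the number of nodes. The potential sink [x] from [clique_sink] is either the head
    of the clique or outside it; with [x] removed, the rest of the clique is prescribed for the
    remaining nodes. *)
Lemma clique_elim_order G s c : is_mpdag G -> uniq s -> elim_order G s ->
  uniq c -> {subset c <= s} -> {in c &, forall x y, x != y -> adj G x y} ->
  pairwise (fun x y => ~~ dir G x y) c ->
  exists t, [/\ perm_eq t s, elim_order G t & subseq c t].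
Proof.
move=> mG; have [n] := ubnP (size s); elim: n s c => // n IH s c.
rewrite ltnS => sn us es uc sub cl pw.
case: c uc sub cl pw => [|k c] uc sub cl pw.
  by exists s; rewrite sub0seq.
case: s sn us es sub => [|a s0] sn us es sub.
  by have := sub k (mem_head _ _).
have [x [t [pt [sx et] xc]]] : exists x t, [/\ perm_eq (x :: t) (a :: s0),
    elim_order G (x :: t) & x \notin c].
  apply: (clique_sink mG _ us es uc sub cl pw) => s' c' le.
  by apply: IH; exact: leq_ltn_trans le sn.
have ut : uniq t by move: us; rewrite -(perm_uniq pt) => /andP[].
have tn : size t < n by have := perm_size pt => /= -[->].
have subt y : y \in k :: c -> y != x -> y \in t.
  by move=> /sub; rewrite -(perm_mem pt) inE => /orP[->|].
have fin c' : uniq c' -> {subset c' <= t} -> subseq c' (k :: c) ->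
    exists t', [/\ perm_eq (x :: t') (a :: s0), elim_order G (x :: t')
      & subseq c' t'].
  move=> uc' s' sc; have [||t' [pt' et' st']] := IH t c' tn ut et uc' s'.
  - by move=> y z /(mem_subseq sc) yc /(mem_subseq sc); exact: cl.
  - exact: subseq_pairwise pw.
  exists t'; split=> //; first by rewrite (perm_trans _ pt) // perm_cons.
  by split=> //; apply: potential_sink_sub sx => y; rewrite (perm_mem pt').
have [xk|xk] := eqVneq x k.
  have [||t' [pt' et' st']] := fin c _ _ (subseq_cons c k).
  - by case/andP: uc.
  - move=> y yc; apply: subt; first by rewrite inE yc orbT.
    by apply: contraNneq xc => <-.
  by exists (x :: t'); split=> //=; rewrite xk eqxx.
have [|t' [pt' et' st']] := fin (k :: c) uc _ (subseq_refl _).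
  move=> y yc; apply: (subt _ yc); apply: contraTneq yc => ->.
  by rewrite inE negb_or xk.
exists (x :: t'); split=> //.
exact: subseq_trans st' (subseq_cons _ _).
Qed.

End EliminationOrders.

(** * Elimination orders and represented DAGs *)

Section Orientations.
Context {V : finType}.
Implicit Types (G D : graph V) (a b c x y z : V) (s t p q : seq V).

Definition order_dir G s : rel V :=
  fun x y => adj G x y && (index y s < index x s).

Lemma order_dir_irr G s : irreflexive (order_dir G s).
Proof. by move=> x; rewrite /order_dir ltnn andbF. Qed.

Lemma order_dir_asym G s x y : order_dir G s x y -> ~~ order_dir G s y x.
Proof. by case/andP=> _ xy; rewrite /order_dir ltnNge (ltnW xy) andbF. Qed.

Definition order_graph G s : graph V :=
  @Graph V (order_dir G s) (fun _ _ => false) (@order_dir_irr G s)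
    (fun=> erefl) (fun _ _ => erefl) (@order_dir_asym G s)
    (fun _ _ _ => isT).

Lemma order_graph_adj G s x y : (forall z, z \in s) ->
  adj (order_graph G s) x y = adj G x y.
Proof.
move=> sT; rewrite {1}/adj /= /order_dir orbF [adj G y x]adj_sym -andb_orr.
have [->|xy] := eqVneq x y; first by rewrite adj_irr.
rewrite -neq_ltn (_ : _ != _) ?andbT // eq_sym.
by apply: contra_neq xy => e; rewrite -(nth_index x (sT x)) e nth_index.
Qed.

(** Indices decrease along edges, which excludes cycles. If an edge of an unshielded collider at [b]
    were undirected in [G], the sink condition at [b] would make the two tails adjacent. *)
Lemma represented_order_graph G s : uniq s -> (forall z, z \in s) ->
  elim_order G s -> represented G (order_graph G s).
Proof.
move=> us sT es; split.
- split=> // -[x [p [/andP[_ +] /andP[_]]]].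
  suff le : path (order_dir G s) x p -> index (last x p) s <= index x s.
    by move=> /le; rewrite leqNgt => /negP.
  elim: p x => //= y p IH x /andP[/andP[_ /ltnW xy] /IH yp].
  exact: leq_trans yp xy.
- by move=> x y; exact: order_graph_adj.
- move=> a b c; rewrite /unshielded_collider order_graph_adj //=.
  have [ac|//=] := boolP (a != c); rewrite ?andbF //=.
  have [|nac] := boolP (adj G a c); rewrite ?andbF //= !andbT.
  apply/andP/andP => -[ab cb]; last first.
    by rewrite /order_dir !dir_adj // !(elim_order_dir es).
  suff h x y : order_dir G s x b -> order_dir G s y b -> ~~ adj G x y ->
      x != y -> dir G x b.
    split; first exact: (h a c).
    by apply: (h c a) => //; rewrite ?[adj _ c _]adj_sym // eq_sym.
  case/andP=> xb bx /andP[yb byi] nxy xy.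
  have [nbx h'] := elim_order_index es us (sT b) (sT x) bx.
  case/or3P: xb => // [|uxb]; first by rewrite (negbTE nbx).
  case/negP: nxy; apply: h' => //; first by rewrite und_sym.
  by rewrite adj_sym.
- by move=> x y xy /=; rewrite /order_dir dir_adj //= (elim_order_dir es).
Qed.

Lemma pdag_acyclic D x y : is_pdag D -> dir D x y ->
  connect (dir D) y x = false.
Proof.
move=> aD xy; apply/negP => /connectP[p pp xp]; apply: aD.
move: xp xy; case: (shortenP pp) => q pq uq _ -> xy.
exists y, q; split=> //; apply/andP; split=> //; apply/andP; split=> //.
by apply: sub_path pq => ? ?; exact: dir_adj.
Qed.

(** The number of descendants, the node itself included; sorting by it lists children before
    parents. *)
Definition dag_rank D x := #|connect (dir D) x|.

Lemma dag_rank_lt D x y : is_pdag D -> dir D x y -> dag_rank D y < dag_rank D x.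
Proof.
move=> aD xy; apply: proper_card; apply/properP; split.
  by apply/fintype.subsetP => z; rewrite !inE; apply: connect_trans; exact: connect1.
by exists x; rewrite !inE ?connect0 // (pdag_acyclic aD).
Qed.

Lemma represented_collider G D a b c : represented G D ->
  dir D a b -> dir D c b -> a != c -> ~~ adj G a c -> dir G a b /\ dir G c b.
Proof.
move=> [_ Dadj Dcol _] ab cb ac nac.
have := Dcol a b c; rewrite /unshielded_collider ab cb ac Dadj nac /=.
by case/esym/and3P.
Qed.

Lemma represented_adjP G D x y : represented G D -> adj G x y ->
  dir D x y \/ dir D y x.
Proof.
move=> [[_ nuD] Dadj _ _]; rewrite -Dadj => /or3P[]; [by left|by right|].
by rewrite (negbTE (nuD _ _)).
Qed.

(** Each node is a sink of [D] among the nodes listed after it. Two nonadjacent neighbours there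
    form an unshielded collider, so [G] shares it and neither edge is undirected. *)
Lemma represented_elim_order G D : represented G D ->
  exists s, [/\ uniq s, forall z, z \in s & elim_order G s].
Proof.
move=> rD; have [[aD nuD] Dadj Dcol Dsub] := rD.
pose r := relpre (dag_rank D) leq.
exists (sort r (enum V)); split.
- by rewrite sort_uniq enum_uniq.
- by move=> z; rewrite mem_sort mem_enum.
have : pairwise r (sort r (enum V)).
  rewrite -sorted_pairwise; last by move=> ? ? ?; exact: leq_trans.
  by apply: sort_sorted => x y; exact: leq_total.
elim: (sort _ _) => //= x s IH /andP[/allP xs /IH es]; split=> // y ys.
have nd z : z \in s -> ~~ dir D x z.
  move=> /xs; rewrite /r /= leqNgt; apply: contra; exact: dag_rank_lt.
split; first by apply: contra (nd y ys); exact: Dsub.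
move=> uxy z zs axz yz; apply/negPn/negP => nyz.
have into u : u \in s -> adj G x u -> dir D u x.
  by move=> us /(represented_adjP rD) [|//]; rewrite (negbTE (nd u us)).
have [yx _] := represented_collider rD (into y ys (und_adj uxy))
  (into z zs axz) yz nyz.
by rewrite und_sym (dir_not_und yx) in uxy.
Qed.

Lemma und_orientable G x y : is_mpdag G -> und G x y ->
  exists D, represented G D /\ dir D x y.
Proof.
move=> mG uxy; have [_ [D0 rD0] _ _] := mG.
have [s [us sT es]] := represented_elim_order rD0.
have xy : x != y by apply: contraTneq uxy => ->; rewrite und_irr.
(* Lists run backwards in time, so [y] comes first to obtain [x -> y]. *)
have [||||t [pt et st]] := @clique_elim_order _ G s [:: y; x] mG us es.
- by rewrite /= inE eq_sym xy.
- by [].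
- move=> u v; rewrite !inE => /orP[/eqP->|/eqP->] /orP[/eqP->|/eqP->];
    rewrite ?eqxx // => _; last exact: und_adj.
  by rewrite adj_sym und_adj.
- rewrite /= !andbT; apply/negP => /dir_not_und; by rewrite und_sym uxy.
have ut : uniq t by rewrite (perm_uniq pt).
have tT z : z \in t by rewrite (perm_mem pt).
exists (order_graph G t); split; first exact: represented_order_graph.
rewrite /= /order_dir und_adj //=; apply: (subseq_index ut st).
exact: mem_head.
Qed.

(** * Chordless possibly causal paths *)

Fixpoint chordless G p : bool :=
  if p is a :: p' then
    all (fun z => ~~ adj G a z) (behead p') && chordless G p'
  else true.

Lemma split_last_has (P : pred V) p : has P p ->
  exists p1 z p2, [/\ p = p1 ++ z :: p2, P z & ~~ has P p2].
Proof.
elim: p => //= a p IH; have [hp _|np] := boolP (has P p).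
  by have [p1 [z [p2 [-> Pz nP]]]] := IH hp; exists (a :: p1), z, p2.
by rewrite orbF => Pa; exists [::], a, p.
Qed.

(** Jumping from [a] to its last neighbour on the path leaves no chord at [a]; the same is repeated
    from there. *)
Lemma chordless_subpath G a p : path (adj G) a p -> exists q,
  [/\ subseq q p, last a q = last a p, path (adj G) a q & chordless G (a :: q)].
Proof.
have [n] := ubnP (size p); elim: n a p => // n IH a [|b p] sn pp.
  by exists [::].
have /split_last_has[p1 [z [p2 [e az nz]]]] : has (adj G a) (b :: p).
  by move: pp => /= /andP[-> _].
have pz : path (adj G) z p2.
  by move: pp; rewrite e cat_path /= => /and3P[].
have [|q [sq lq pq cq]] := IH z p2 _ pz.
  by move: sn; rewrite e size_cat /= addnS !ltnS; apply: leq_ltn_trans; exact: leq_addl.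
exists (z :: q); split.
- rewrite e -[z :: q]cat0s; apply: cat_subseq; first exact: sub0seq.
  by rewrite /= eqxx.
- by rewrite e last_cat /= lq.
- by rewrite /= az.
- apply/andP; split=> //=; apply/allP => u /(mem_subseq sq) up.
  by apply: contra nz => au; apply/hasP; exists u.
Qed.

(** The first edge turned backwards would complete an unshielded collider; [G] would then contain
    that backward edge. *)
Lemma chordless_forward G D a b p : represented G D -> uniq (a :: b :: p) ->
  path (adj G) a (b :: p) -> chordless G (a :: b :: p) ->
  pairwise (fun x y => ~~ dir G y x) (a :: b :: p) ->
  dir D a b -> path (dir D) a (b :: p).
Proof.
move=> rD; elim: p a b => [|c p IH] a b up pp cp pw ab; first by rewrite /= ab.
rewrite [path _ _ _]/= ab; apply: IH.
- by case/andP: up.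
- by case/andP: pp.
- by case/andP: cp.
- by case/andP: pw.
have bc : adj G b c by move: pp => /= /and3P[].
have ac : a != c by apply: contraTneq up => ->; rewrite /= !inE eqxx orbT.
have nac : ~~ adj G a c by move: cp => /= /andP[/andP[]].
have ncb : ~~ dir G c b by move: pw => /= /andP[_ /andP[/andP[]]].
case: (represented_adjP rD bc) => // cb.
by have [_] := represented_collider rD ab cb ac nac; rewrite (negbTE ncb).
Qed.

(** If the first edge points forward, so does the whole path and [a] is the root; otherwise the root
    of the tail also reaches [a]. The last clause transfers a parent [x] of the first node to the
    root. *)
Lemma chordless_root G D a p : represented G D -> uniq (a :: p) ->
  path (adj G) a p -> chordless G (a :: p) ->
  pairwise (fun x y => ~~ dir G y x) (a :: p) ->
  exists r, [/\ r \in a :: p,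
    forall z, z \in a :: p -> connect (dir D) r z,
    forall z, z \in a :: p -> z != r -> exists2 y, y \in a :: p & dir D y z
    & forall x, x \notin a :: p ->
        (forall z, z \in p -> adj G x z -> dir G x z) ->
        dir D x a -> dir D x r].
Proof.
move=> rD; elim: p a => [|b p IH] a up pp cp pw.
  exists a; split=> //; first exact: mem_head.
    by move=> z; rewrite inE => /eqP->; exact: connect0.
  by move=> z; rewrite inE => ->.
have ab : adj G a b by case/andP: pp.
case: (represented_adjP rD ab) => {}ab.
  have fp := chordless_forward rD up pp cp pw ab.
  exists a; split=> //; first exact: mem_head.
    move=> z zp; move: fp; case/splitPl: zp => p1 p2 lz.
    by rewrite cat_path => /andP[h _]; apply/connectP; exists p1.
  move=> z; rewrite inE => /orP[/eqP->|zp _]; first by rewrite eqxx.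
  move: fp zp; move: (b :: p) => q.
  elim: q {up pp cp pw ab} a => //= c q IHq a /andP[ac cq].
  rewrite inE => /orP[/eqP->|zq]; first by exists a => //; exact: mem_head.
  have [y yq yz] := IHq c cq zq.
  by exists y => //; rewrite inE yq orbT.
have [||||r [rp rc rpar rx]] := IH b;
  try by [case/andP: up|case/andP: pp|case/andP: cp|case/andP: pw].
have bp : b \in b :: p by exact: mem_head.
exists r; split.
- by rewrite inE rp orbT.
- move=> z; rewrite inE => /orP[/eqP->|]; last exact: rc.
  by apply: connect_trans (rc b bp) _; exact: connect1.
- move=> z; rewrite inE => /orP[/eqP-> _|zp zr].
    by exists b => //; rewrite inE bp orbT.
  by have [y yp yz] := rpar z zp zr; exists y => //; rewrite inE yp orbT.
move=> x; rewrite !inE !negb_or => /and3P[xa xb xp] xdir dxa.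
have [_ _ _ Dsub] := rD.
have nba : ~~ dir G b a by move: pw => /= /andP[/andP[]].
apply: rx.
- by rewrite inE negb_or xb.
- by move=> z zp; apply: xdir; rewrite inE zp orbT.
(* Were [x] and [b] nonadjacent, [x -> a <- b] would be a collider of [G], against the absence of
   backward edges. *)
apply: Dsub; apply: xdir => //; apply/negPn/negP => nxb.
by have [_] := represented_collider rD dxa ab xb nxb; rewrite (negbTE nba).
Qed.

End Orientations.

(** * Mixtures of product densities *)

Section IteratedIntegrals.
Import Order.TTheory GRing.Theory Num.Theory numFieldNormedType.Exports.
Local Open Scope classical_set_scope.
Local Open Scope ring_scope.
Context (R : realType) {V : finType}.
Implicit Types (v u : V -> R) (h : (V -> R) -> \bar R) (i j : V) (W : {set V}).

Local Notation mu := (@lebesgue_measure R).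

(* The library's monotonicity of the integral asks for measurable functions;
   the sections of a set that is measurable in R^V are not known to be so here. *)
Lemma le_integral_ge0 (f g : R -> \bar R) : (forall t, 0 <= f t)%E ->
  (forall t, f t <= g t)%E -> (\int[mu]_t f t <= \int[mu]_t g t)%E.
Proof.
move=> f0 fg; have g0 t : (0 <= g t)%E by exact: le_trans (fg t).
rewrite !ge0_integralE //; apply: le_ereal_sup => _ [k /= kf <-].
exists k => // t; by apply: le_trans (kf t) _; rewrite !patch_setT.
Qed.

Lemma integral_over0 W v : integral_over W (fun=> 0%E) v = 0%E.
Proof.
rewrite /integral_over; elim: (enum W) v => //= j l IH v.
by rewrite -[RHS](integral0 mu [set: R]); apply: eq_integral => t _; exact: IH.
Qed.

Lemma le_integral_over W h1 h2 v : (forall u, 0 <= h1 u)%E ->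
  (forall u, h1 u <= h2 u)%E -> (integral_over W h1 v <= integral_over W h2 v)%E.
Proof.
move=> h0 h12; rewrite /integral_over; elim: (enum W) v => //= j l IH v.
apply: le_integral_ge0 => t //; elim: l {IH} (upd v j t) => //= k l IH u.
by apply: integral_ge0 => r _.
Qed.

Lemma eq_integral_over W h1 h2 v :
  (forall u, (forall i, i \notin W -> u i = v i) -> h1 u = h2 u) ->
  integral_over W h1 v = integral_over W h2 v.
Proof.
have -> : (forall u, (forall i, i \notin W -> u i = v i) -> h1 u = h2 u) =
  (forall u, (forall i, i \notin enum W -> u i = v i) -> h1 u = h2 u).
  by apply/propext; split=> H u uv; apply: H => i; have := uv i; rewrite mem_enum.
rewrite /integral_over; elim: (enum W) v => /= [|j l IH] v hv.
  by apply: hv.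
apply: eq_integral => t _; apply: IH => u uv; apply: hv => i.
rewrite inE negb_or => /andP[ij il]; rewrite uv // /upd.
by rewrite (negbTE ij).
Qed.

Section Mixtures.
Variables (I : finType) (g : I -> V -> R -> R).
Hypothesis mg : forall s i, measurable_fun [set: R] (g s i).
Hypothesis g0 : forall s i t, 0 <= g s i t.
Hypothesis g1 : forall s i, (\int[mu]_t (g s i t)%:E = 1)%E.

(** The predicate [P] selects the coordinates that are still present, so that marginals have the
    same form as the density itself. *)
Definition mixture (a : I -> R) (P : pred V) v : R :=
  \sum_s a s * \prod_(i | P i) g s i (v i).

Lemma mixture_ge0 a P v : (forall s, 0 <= a s) -> 0 <= mixture a P v.
Proof.
by move=> a0; apply: sumr_ge0 => s _; apply: mulr_ge0 => //; apply: prodr_ge0.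
Qed.

(** In each component an integrated coordinate contributes a factor of integral one and drops out of
    [P]. *)
Lemma integral_over_mixture W a P v : (forall s, 0 <= a s) ->
  {subset W <= P} ->
  integral_over W (fun u => (mixture a P u)%:E) v =
  (mixture a (fun i => P i && (i \notin W)) v)%:E.
Proof.
move=> a0 WP; have -> : mixture a (fun i => P i && (i \notin W)) v =
    mixture a (fun i => P i && (i \notin enum W)) v.
  by apply: eq_bigr => s _; congr (_ * _); apply: eq_bigl => i; rewrite mem_enum.
rewrite /integral_over; have : {subset enum W <= P}.
  by move=> i; rewrite mem_enum; exact: WP.
have := enum_uniq W; elim: (enum W) v => /= [|j l IH] v.
  by move=> _ _; congr EFin; apply: eq_bigr => s _; congr (_ * _);
    apply: eq_bigl => i; rewrite andbT.
move=> /andP[jl ul] lP.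
have lP' : {subset l <= P} by move=> i il; apply: lP; rewrite inE il orbT.
transitivity (\int[mu]_t (\sum_s (a s *
    \prod_(i | P i && (i \notin j :: l)) g s i (v i))%:E * (g s j t)%:E))%E.
  apply: eq_integral => t _; rewrite IH // /mixture -sumEFin.
  apply: eq_bigr => s _; rewrite -EFinM; congr EFin.
  rewrite (bigD1 j) /=; last first.
    by rewrite jl andbT; apply: lP; exact: mem_head.
  rewrite {1}/upd eqxx mulrCA mulrC; congr (_ * _ * _).
  apply: eq_big => [i|i].
    by rewrite inE negb_or -andbA [_ && (i != j)]andbC.
  by case/andP=> _ /negbTE ij; rewrite /upd ij.
have c0 s : (0 <= a s * \prod_(i | P i && (i \notin j :: l)) g s i (v i))%R.
  by apply: mulr_ge0 => //; apply: prodr_ge0.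
rewrite ge0_integral_sum //; first last.
- by move=> s t _; rewrite mule_ge0 // lee_fin.
- by move=> s; apply: measurable_funeM; apply/measurable_EFinP; exact: mg.
rewrite /mixture -sumEFin; apply: eq_bigr => s _.
rewrite ge0_integralZl_EFin //; first by rewrite g1 mule1.
- by move=> t _; rewrite lee_fin.
- by apply/measurable_EFinP; exact: mg.
Qed.

Lemma measurable_coord i : measurable_fun [set: @assignment R V]
  ((fun v => v i) : @assignment R V -> R).
Proof.
move=> _ B mB; rewrite setTI; apply: sub_sigma_algebra.
by exists i, B.
Qed.

Lemma measurable_mixture a :
  measurable_fun [set: @assignment R V] (mixture a predT).
Proof.
apply: measurable_sum => s; apply: measurable_funM => //.
apply: measurable_prod => i _.
exact: (measurableT_comp (mg s i) (measurable_coord i)).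
Qed.

Lemma mixture_is_density a : (forall s, 0 <= a s) -> \sum_s a s = 1 ->
  is_density (mixture a predT).
Proof.
move=> a0 a1; split.
- exact: measurable_mixture.
- by move=> v; exact: mixture_ge0.
move=> v; rewrite integral_over_mixture // -a1; congr EFin.
by apply: eq_bigr => s _; rewrite big1 ?mulr1 // => i; rewrite /= finset.in_setT.
Qed.

Lemma marginal_mixture a S v : (forall s, 0 <= a s) ->
  marginal (mixture a predT) S v = mixture a (mem S) v.
Proof.
move=> a0; rewrite /marginal integral_over_mixture //=.
by apply: eq_bigr => s _; congr (_ * _); apply: eq_bigl => i; rewrite inE negbK.
Qed.

End Mixtures.

End IteratedIntegrals.

(** * The density of a hidden bit *)

Section LatentBit.
Import Order.TTheory GRing.Theory Num.Theory numFieldNormedType.Exports.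
Local Open Scope classical_set_scope.
Local Open Scope ring_scope.
Context (R : realType) {V : finType}.
Implicit Types (v u : V -> R) (i j y z : V) (s : bool) (S Z X Y : {set V}).

Local Notation mu := (@lebesgue_measure R).

(** Disjoint intervals of length one: a real variable shows a bit by its cell, and the indicators
    are probability densities. *)
Definition cell s : set R := if s then `[0, 1[%classic else `[1, 2[%classic.

Lemma measurable_cell s : measurable (cell s).
Proof. by case: s; exact: measurable_itv. Qed.

Lemma cell_inj s s' t : t \in cell s -> t \in cell s' -> s = s'.
Proof.
by case: s s' => [] [] //; rewrite !inE /= !in_itv /= => /andP[a b] /andP[c d];
  exfalso; lra.
Qed.

Lemma measurable_indic_cell s : measurable_fun [set: R] (\1_(cell s) : R -> R).
Proof. exact: measurable_indic (measurable_cell s). Qed.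

Lemma integral_cell s : (\int[mu]_t (\1_(cell s) t)%:E = 1)%E.
Proof.
rewrite integral_indic //; last exact: measurable_cell.
rewrite setIT; case: s; rewrite /cell /= lebesgue_measure_itv /= lte_fin.
  by rewrite ltr01 sube0.
by rewrite ltr1n /= -EFinB; congr EFin; lra.
Qed.

Lemma indic_ge0 (A : set R) t : 0 <= \1_A t :> R.
Proof. by rewrite indicE. Qed.

(** The box has volume one, computed as a mixture with a single component, and its indicator is
    below that of any measurable cover of [N]. *)
Lemma box_not_null (N : set (V -> R)) :
  (forall v, (forall i, v i \in cell true) -> N v) -> ~ lebesgue_null N.
Proof.
move=> boxN [A [_ A0 NA]].
pose g (_ : unit) (_ : V) : R -> R := \1_(cell true).
have g0 (s : unit) i t : 0 <= g s i t by exact: indic_ge0.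
have : (integral_over [set: V] (fun u => (mixture g (fun=> 1) predT u)%:E)
    (fun=> 0%R) <= 0)%E.
  rewrite -[leRHS](A0 (fun=> 0)); apply: le_integral_over => u.
    by rewrite lee_fin; exact: mixture_ge0.
  rewrite lee_fin /mixture (big_pred1 tt); last by case.
  rewrite mul1r indicE.
  have [uA|/negP uA] := boolP (u \in A).
    apply: prodr_ile1 => i _; rewrite /g indicE.
    by case: (_ \in _); rewrite ler01 lexx.
  have [|/existsP[i]] := boolP [forall i, u i \in cell true].
    by move/forallP/boxN/NA/mem_set.
  by move=> nui; rewrite (bigD1 i) //= /g indicE (negbTE nui) mul0r.
have mg (s : unit) i : measurable_fun [set: R] (g s i).
  by exact: measurable_indic_cell.
have g1 (s : unit) i : (\int[mu]_t (g s i t)%:E = 1)%E by exact: integral_cell.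
rewrite (integral_over_mixture mg g0 g1) //.
rewrite lee_fin /mixture (big_pred1 tt) /=; last by case.
rewrite big1 ?mulr1 ?ler10 // => i.
by rewrite finset.in_setT.
Qed.

Variables (x : V) (U : {set V}).
Hypothesis xU : x \notin U.

(* Given a uniform bit [s], the nodes of [U] lie in [cell s], the node [x] lies
   there with probability 3/4 only, and all other nodes are independent of [s]. *)
Definition latent_factor s i (t : R) : R :=
  if i \in U then \1_(cell s) t
  else if i == x then 3 / 4 * \1_(cell s) t + 1 / 4 * \1_(cell (~~ s)) t
  else \1_(cell true) t.

Lemma measurable_factor s i : measurable_fun [set: R] (latent_factor s i).
Proof.
rewrite /latent_factor; case: (i \in U); first exact: measurable_indic_cell.
case: (i == x); last exact: measurable_indic_cell.
by apply: measurable_funD; apply: measurable_funM => //;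
  exact: measurable_indic_cell.
Qed.

Lemma factor_ge0 s i t : 0 <= latent_factor s i t.
Proof.
rewrite /latent_factor; have h s' := indic_ge0 (cell s') t.
by case: ifP => // _; case: ifP => // _; have := h s; have := h (~~ s); lra.
Qed.

Lemma integral_factor s i : (\int[mu]_t (latent_factor s i t)%:E = 1)%E.
Proof.
rewrite /latent_factor; case: (i \in U); first exact: integral_cell.
case: (i == x); last exact: integral_cell.
have mc s' : measurable_fun [set: R] (fun t => (\1_(cell s') t)%:E : \bar R).
  by apply/measurable_EFinP; exact: measurable_indic_cell.
have c0 s' t : [set: R] t -> (0 <= (\1_(cell s') t)%:E :> \bar R)%E.
  by move=> _; rewrite lee_fin indic_ge0.
have k0 (k : R) s' : 0 <= k ->
    forall t, [set: R] t -> (0 <= k%:E * (\1_(cell s') t)%:E)%E.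
  by move=> ? t tT; rewrite mule_ge0 // c0.
have [a0 b0] : 0 <= 3 / 4 :> R /\ 0 <= 1 / 4 :> R by split; lra.
under eq_integral do rewrite EFinD (EFinM (3 / 4)) (EFinM (1 / 4)).
rewrite ge0_integralD //; try exact: (k0 _ _ a0); try exact: (k0 _ _ b0);
  try by apply: measurable_funeM; exact: mc.
rewrite !ge0_integralZl_EFin //; try exact: c0; try exact: mc.
by rewrite !integral_cell !mule1 -EFinD; congr EFin; lra.
Qed.

Lemma factor_in s i t : i \in U -> (latent_factor s i t != 0) = (t \in cell s).
Proof. by rewrite /latent_factor => ->; rewrite indicE pnatr_eq0 eqb0 negbK. Qed.

Lemma factor_in1 s i t : i \in U -> latent_factor s i t != 0 -> latent_factor s i t = 1.
Proof.
by move=> iU; rewrite factor_in // /latent_factor iU indicE => ->.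
Qed.

Lemma factor_in_inj s s' i t : i \in U ->
  latent_factor s i t != 0 -> latent_factor s' i t != 0 -> s = s'.
Proof. by move=> iU; rewrite !factor_in //; exact: cell_inj. Qed.

Lemma factor_out1 s i t : i \notin U -> i != x -> latent_factor s i t != 0 ->
  latent_factor s i t = 1.
Proof.
rewrite /latent_factor => /negbTE-> /negbTE->.
by rewrite indicE pnatr_eq0 eqb0 negbK => ->.
Qed.

(** Both weights 3/4 and 1/4 are positive, so only the nodes of [U] have a support that depends on
    the bit. *)
Lemma factor_out s s' i t : i \notin U -> latent_factor s i t != 0 ->
  latent_factor s' i t != 0.
Proof.
rewrite /latent_factor => /negbTE->; case: ifP => _ //; rewrite !indicE.
have nn (p q : bool) : (3 / 4 * p%:R + 1 / 4 * q%:R != 0 :> R) = p || q.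
  by case: p q => [] [] /=; apply/eqP; try lra.
by rewrite !nn; case: s s' => [] [] //=; rewrite orbC.
Qed.

Lemma factor_x s t : latent_factor s x t != 0 ->
  latent_factor true x t + latent_factor false x t = 1.
Proof.
rewrite /latent_factor (negbTE xU) eqxx /= !indicE => h.
have : (t \in cell true) (+) (t \in cell false).
  have [t1|/negPf t1] := boolP (t \in cell true);
    have [t2|/negPf t2] := boolP (t \in cell false) => //=.
    by have := cell_inj t1 t2.
  by move: h; case: s; rewrite /= t1 t2 !mulr0 addr0 eqxx.
by case: (t \in cell true); case: (t \in cell false) => //= _; lra.
Qed.

Definition latent : (V -> R) -> R := mixture latent_factor (fun=> 1 / 2) predT.

Lemma half_ge0 (s : bool) : 0 <= 1 / 2 :> R.
Proof. by lra. Qed.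

Lemma latent_is_density : is_density latent.
Proof.
apply: mixture_is_density.
- exact: measurable_factor.
- exact: factor_ge0.
- exact: integral_factor.
- exact: half_ge0.
- by rewrite big_bool /=; lra.
Qed.

Lemma marginal_latent S v :
  marginal latent S v = mixture latent_factor (fun=> 1 / 2) (mem S) v.
Proof.
apply: marginal_mixture; last exact: half_ge0.
- exact: measurable_factor.
- exact: factor_ge0.
- exact: integral_factor.
Qed.

Lemma mixture_factor_neq0 (a : bool -> R) (P : pred V) v :
  mixture latent_factor a P v != 0 ->
  exists s, forall i, P i -> latent_factor s i (v i) != 0.
Proof.
move=> m0; apply: contrapT => /forallNP h; move: m0; rewrite /mixture big1 ?eqxx //.
move=> s _; have /existsNP[i /not_implyP[Pi /negP]] := h s.
by rewrite negbK => /eqP f0; rewrite (bigD1 i) //= f0 mul0r mulr0.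
Qed.

(** Where they do not vanish, all factors but that of [x] are indicators and equal to one. *)
Lemma prod_factor s (P : pred V) v : (forall i, P i -> latent_factor s i (v i) != 0) ->
  \prod_(i | P i) latent_factor s i (v i) = if P x then latent_factor s x (v x) else 1.
Proof.
move=> f0; have f1 i : P i -> i != x -> latent_factor s i (v i) = 1.
  move=> Pi ix; have [iU|iU] := boolP (i \in U).
    exact: factor_in1 (f0 i Pi).
  exact: factor_out1 (f0 i Pi).
case: ifP => Px; last first.
  by rewrite big1 // => i Pi; apply: f1 => //; apply: contraFneq Px => <-.
by rewrite (bigD1 x) //= big1 ?mulr1 // => i /andP[]; exact: f1.
Qed.

(* Once a node of [U] is involved, only one value of the bit survives. *)
Lemma mixture_factor_in s (a : bool -> R) (P : pred V) v z :
  (forall i, P i -> latent_factor s i (v i) != 0) -> z \in U -> P z ->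
  mixture latent_factor a P v = a s * if P x then latent_factor s x (v x) else 1.
Proof.
move=> f0 zU Pz; rewrite /mixture (bigD1 s) //= prod_factor //.
rewrite big1 ?addr0 // => s' ss'; rewrite (bigD1 z) //=.
suff -> : latent_factor s' z (v z) = 0 by rewrite mul0r mulr0.
apply: contra_neq_eq ss' => f'; apply: factor_in_inj zU f' _.
exact: f0.
Qed.

(** The case in which the values at [S] determine the hidden bit. *)
Definition hits S : bool := [exists y in U, y \in S].

(** If [S] meets [U], only the component of [s] survives. Otherwise both do, and the two values of
    the factor of [x] add up to one. *)
Lemma marginal_latent_supp s S v : (forall i, latent_factor s i (v i) != 0) ->
  marginal latent S v =
  if hits S then 1 / 2 * (if x \in S then latent_factor s x (v x) else 1)
  else if x \in S then 1 / 2 else 1.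
Proof.
move=> f0; rewrite marginal_latent; case: ifP => [/existsP[z /andP[zU zS]]|nS].
  exact: mixture_factor_in zU zS.
have fS s' i : i \in S -> latent_factor s' i (v i) != 0.
  move=> iS; apply: (@factor_out s); last exact: f0.
  by apply: contraFN nS => iU; apply/existsP; exists i; rewrite iU.
rewrite /mixture big_bool /= !prod_factor //=; try exact: fS.
case: ifP => _; last by lra.
by have := factor_x (f0 x); lra.
Qed.

Lemma conditional_latent s i S v : (forall i, latent_factor s i (v i) != 0) ->
  i \notin S ->
  conditional latent i S v =
  if i \in U then
    if hits S then 1 else if x \in S then latent_factor s x (v x) else 1 / 2
  else if i == x then if hits S then latent_factor s x (v x) else 1 / 2
  else 1.
Proof.
move=> f0 iS; rewrite /conditional !(marginal_latent_supp _ f0).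
have -> : hits (i |: S) = (i \in U) || hits S.
  apply/existsP/orP => [[y /andP[yU]]|[iU|/existsP[y /andP[yU yS]]]].
  - rewrite in_setU1 => /orP[/eqP <-|yS]; first by left.
    by right; apply/existsP; exists y; rewrite yU.
  - by exists i; rewrite iU setU11.
  - by exists y; rewrite yU setU1r.
rewrite in_setU1 [x == i]eq_sym; have q0 := f0 x.
have [iU|iU] /= := boolP (i \in U).
  have -> : (i == x) = false by apply: contraNF xU => /eqP<-.
  by case: (hits S); case: (x \in S) => /=; field; rewrite ?q0.
have [ix|ix] /= := eqVneq i x.
  by rewrite -ix (negbTE iS) ix; case: (hits S); field; rewrite ?q0.
by case: (hits S); case: (x \in S) => /=; field; rewrite ?q0.
Qed.

(** * The truncated factorization of the latent density *)

Section Orientation.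
Variables (D : graph V) (b : bool) (r : V).
Hypothesis aD : is_pdag D.
Hypothesis rU : r \in U.
Hypothesis r_par : forall y, y \in U -> ~~ dir D y r.
Hypothesis U_par : forall z, z \in U -> z != r ->
  exists2 y, y \in U & dir D y z.
Hypothesis x_r : dir D x r = b.
Hypothesis x_par : hits (parents D x) = ~~ b.

Lemma in_parents i y : (y \in parents D i) = dir D y i.
Proof. by rewrite /parents inE. Qed.

(** Only [r] and [x] have conditional densities other than one, since every other node of [U] sees
    the bit at a parent. The flag [b] treats both orientations at once: for [b] true, [r] depends on
    [x]; for [b] false, [x] depends on a parent in [U]. The set [Z] is empty for the observational
    density. *)
Lemma truncated_supp s Z v : {in Z, forall z, z \notin U} ->
  (forall i, latent_factor s i (v i) != 0) ->
  \prod_(i | i \notin Z) conditional latent i (parents D i) v =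
  (if b then latent_factor s x (v x) else 1 / 2) *
  (if x \in Z then 1 else if b then 1 / 2 else latent_factor s x (v x)).
Proof.
move=> ZU f0.
have cE i := conditional_latent f0 (i := i) (S := parents D i).
have ipi i : i \notin parents D i by rewrite in_parents dir_irr.
have nZ z : z \in U -> z \notin Z.
  by move=> zU; apply: contraL zU; exact: ZU.
have c1 i : i != r -> i != x -> conditional latent i (parents D i) v = 1.
  move=> ir ix; rewrite cE // (negbTE ix); case: ifP => // iU.
  have [y yU yi] := U_par iU ir.
  suff -> : hits (parents D i) by [].
  by apply/existsP; exists y; rewrite yU in_parents.
rewrite (bigD1 r) ?nZ //= cE // rU.
have -> : hits (parents D r) = false.
  apply/negbTE; rewrite negb_exists; apply/forallP => y.
  by rewrite negb_and in_parents -implybE; apply/implyP => /r_par.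
rewrite in_parents x_r; congr (_ * _).
have xr : x != r by apply: contraNneq xU => ->.
case: ifP => xZ.
  by rewrite big1 // => i /andP[iZ ir]; apply: c1 => //; apply: contraNneq iZ => ->.
rewrite (bigD1 x) ?xZ //= big1 ?mulr1; last by move=> i /andP[/andP[]]; auto.
by rewrite cE // (negbTE xU) eqxx x_par; case: b.
Qed.

Lemma conditional_neq0 i v : conditional latent i (parents D i) v != 0 ->
  exists s, latent_factor s i (v i) != 0 /\
    forall j, dir D j i -> latent_factor s j (v j) != 0.
Proof.
rewrite /conditional mulf_eq0 negb_or => /andP[+ _].
rewrite marginal_latent => /mixture_factor_neq0[s f0]; exists s; split.
  by apply: f0; rewrite inE setU11.
by move=> j ji; apply: f0; rewrite /= setU1r // in_parents.
Qed.

(** A nonzero conditional density makes a node agree on the bit with its parents, so the bit shown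
    by [r] spreads through [U]. *)
Lemma truncated_neq0 Z v : {in Z, forall z, z \notin U} ->
  (forall i, i \notin Z -> conditional latent i (parents D i) v != 0) ->
  exists s, forall i, i \notin Z -> latent_factor s i (v i) != 0.
Proof.
move=> ZU c0; have nZ z : z \in U -> z \notin Z.
  by move=> zU; apply: contraL zU; exact: ZU.
have [s [fr _]] := conditional_neq0 (c0 r (nZ r rU)).
have fU z : z \in U -> latent_factor s z (v z) != 0.
  (* The rank grows from a node to its parents, so the induction runs on its difference from the
     number of nodes. *)
  have [n] := ubnP (#|V| - dag_rank D z); elim: n z => // n IH z zn zU.
  have [->//|zr] := eqVneq z r.
  have [y yU yz] := U_par zU zr.
  have [s' [fz fp]] := conditional_neq0 (c0 z (nZ z zU)).
  have fy : latent_factor s y (v y) != 0.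
    apply: IH yU; move: zn; rewrite ltnS; apply: leq_trans.
    have := dag_rank_lt aD yz => lt.
    by rewrite ltn_sub2l // (leq_trans lt) // max_card.
  by rewrite (factor_in_inj yU fy (fp y yz)).
exists s => i iZ; have [iU|iU] := boolP (i \in U); first exact: fU.
have [s' [fi _]] := conditional_neq0 (c0 i iZ).
exact: factor_out fi.
Qed.

(** On the support both sides are explicit and nonzero. Elsewhere both vanish: a nonzero mixture
    puts [v] in the support, and nonzero conditional densities do so by [truncated_neq0]. With [x]
    fixed and [b] true, the factor of [r] given [x] becomes the weight of the bit. *)
Lemma truncatedE Z v : {in Z, forall z, z \notin U} ->
  (forall i, i \in Z -> latent_factor true i (v i) != 0) ->
  \prod_(i | i \notin Z) conditional latent i (parents D i) v =
  mixture latent_factor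
    (fun s => if b && (x \in Z) then latent_factor s x (v x) else 1 / 2)
    (fun i => i \notin Z) v.
Proof.
move=> ZU fZ.
have [/existsP[i /andP[iZ /eqP ci]]|] := boolP [exists i,
    (i \notin Z) && (conditional latent i (parents D i) v == 0)].
  rewrite (bigD1 i) //= ci mul0r; apply/esym/eqP/negPn/negP.
  move=> /mixture_factor_neq0[s f0].
  have f s' j : latent_factor s j (v j) != 0.
    have [jZ|] := boolP (j \in Z); last exact: f0.
    by apply: factor_out (fZ j jZ); exact: ZU.
  move: (f true) => {}f.
  have /eqP := @truncated_supp s Z v ZU f.
  rewrite (bigD1 i) //= ci mul0r eq_sym; apply/negP.
  have qx := f x.
  by rewrite mulf_neq0 //; repeat case: ifP => _ //; apply/eqP; lra.
rewrite negb_exists => /forallP h.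
have [|s f0] := truncated_neq0 ZU (v := v).
  by move=> i iZ; have := h i; rewrite iZ.
have f j : latent_factor s j (v j) != 0.
  have [jZ|] := boolP (j \in Z); last exact: f0.
  by apply: factor_out (fZ j jZ); exact: ZU.
rewrite (truncated_supp ZU f).
rewrite (@mixture_factor_in s _ _ _ r) //; last by apply: contraL rU; exact: ZU.
by case: b; case: (x \in Z); rewrite /= ?mulr1 // mulrC.
Qed.

Lemma consistent_latent : consistent_dag D latent.
Proof.
split; first exact: latent_is_density.
exists set0; split; first exact: measurable0.
  move=> v; rewrite -[RHS](integral_over0 [set: V] v); apply: eq_integral_over.
  by move=> u _; rewrite indic0.
move=> v /=; apply; have h := @truncatedE finset.set0 v.
rewrite (eq_bigl (fun i => i \notin (finset.set0 : {set V}))); last first.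
  by move=> i; rewrite finset.in_set0.
rewrite h; try by move=> i; rewrite finset.in_set0.
rewrite /latent /mixture; apply: eq_bigr => s _.
rewrite finset.in_set0 andbF; congr (_ * _); apply: eq_bigl => i.
by rewrite finset.in_set0.
Qed.

(** * Interventional densities of the latent density *)

Section Intervention.
Variable X : {set V}.
Hypotheses (xX : x \in X) (XU : {in X, forall z, z \notin U}).

Local Notation weight v :=
  (fun s => if b then latent_factor s x (v x) else 1 / 2).

Lemma integral_over_do (W : {set V}) v : {in W, forall i, i \notin X} ->
  (forall i, i \in X -> latent_factor true i (v i) != 0) ->
  integral_over W (fun u => (do_density D latent X u)%:E) v =
  (mixture latent_factor (weight v) (fun i => (i \notin X) && (i \notin W)) v)%:E.
Proof.
move=> WX fX; transitivity (integral_over W (fun u =>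
    (mixture latent_factor (weight v) (fun i => i \notin X) u)%:E) v).
  apply: eq_integral_over => u uv; congr EFin.
  have XW i : i \in X -> i \notin W by move=> iX; apply: contraL iX; exact: WX.
  rewrite /do_density truncatedE //.
    by apply: eq_bigr => s _; rewrite xX andbT uv // XW.
  by move=> i iX; rewrite uv ?XW // fX.
have w0 s : 0 <= weight v s by case: b; rewrite ?factor_ge0 ?half_ge0.
rewrite (integral_over_mixture measurable_factor factor_ge0 integral_factor) //.
Qed.

(** The total mass is the sum of the two weights, which is one in either orientation. *)
Lemma do_defined_latent v :
  (forall i, i \in X -> latent_factor true i (v i) != 0) ->
  do_defined D latent X v.
Proof.
move=> fX; rewrite /do_defined integral_over_do //; last first.
  by move=> i; rewrite finset.in_setC.
congr EFin; rewrite /mixture big_bool /= !big1 ?mulr1.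
- case: b => /=; last by lra.
  exact: factor_x (fX x xX).
- by move=> i; rewrite finset.in_setC negbK andNb.
- by move=> i; rewrite finset.in_setC negbK andNb.
Qed.

(** The node [z] is not integrated out and shows the bit [true], so only the weight of that bit
    remains. *)
Lemma do_marginal_latent Y v z :
  (forall i, latent_factor true i (v i) != 0) -> z \in U -> z \in Y ->
  do_marginal D latent X Y v = (if b then latent_factor true x (v x) else 1 / 2)%:E.
Proof.
move=> f0 zU zY; rewrite /do_marginal integral_over_do //; last first.
  by move=> i; rewrite finset.in_setC finset.in_setU negb_or => /andP[].
rewrite (@mixture_factor_in true _ _ _ z) ?xX ?mulr1 //.
by rewrite (contraL (@XU z) zU) finset.in_setC negbK finset.in_setU zY orbT.
Qed.

End Intervention.
End Orientation.
End LatentBit.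

(** * Comparison of the two orientations *)

Section TwoOrientations.
Import Order.TTheory GRing.Theory Num.Theory.
Local Open Scope ring_scope.
Context (R : realType) {V : finType}.

Lemma factor_cell x (U : {set V}) i (t : R) : t \in cell true ->
  latent_factor x U true i t != 0.
Proof.
move=> t1; have t0 : (t \in cell false) = false.
  by apply/negP => /(cell_inj t1).
rewrite /latent_factor !indicE t1 /= t0.
by case: (i \in U) => /=; [|case: (i == x)];
  rewrite ?mulr1n ?mulr0n ?oner_eq0 //; apply/eqP; lra.
Qed.

Lemma factor_cellx x (U : {set V}) (t : R) : x \notin U -> t \in cell true ->
  latent_factor x U true x t = 3 / 4.
Proof.
move=> xU t1; have t0 : (t \in cell false) = false.
  by apply/negP => /(cell_inj t1).
by rewrite /latent_factor (negbTE xU) eqxx !indicE t1 /= t0 /= mulr0n mulr1n; lra.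
Qed.

(** The same latent density is consistent with both DAGs, and on the box where all nodes show [true]
    the effect is 3/4 according to [D1] and 1/2 according to [D2]. *)
Lemma not_identifiable_two_orientations (G D1 D2 : graph V) (X Y U : {set V})
    x r1 r2 y :
  represented G D1 -> represented G D2 ->
  x \in X -> {in X, forall z, z \notin U} -> y \in U -> y \in Y ->
  r1 \in U -> r2 \in U ->
  (forall z, z \in U -> ~~ dir D1 z r1) ->
  (forall z, z \in U -> ~~ dir D2 z r2) ->
  (forall z, z \in U -> z != r1 -> exists2 w, w \in U & dir D1 w z) ->
  (forall z, z \in U -> z != r2 -> exists2 w, w \in U & dir D2 w z) ->
  dir D1 x r1 -> dir D2 x r2 = false ->
  ~~ hits U (parents D1 x) -> hits U (parents D2 x) ->
  ~ identifiable R G X Y.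
Proof.
move=> rD1 rD2 xX XU yU yY rU1 rU2 rp1 rp2 Up1 Up2 xr1 xr2 mp1 mp2; apply.
have [[aD1 _] _ _ _] := rD1; have [[aD2 _] _ _ _] := rD2.
have xU := XU x xX.
have c1 := @consistent_latent R V x U xU D1 true r1 aD1 rU1 rp1 Up1 xr1
  (negbTE mp1).
have c2 := @consistent_latent R V x U xU D2 false r2 aD2 rU2 rp2 Up2 xr2 mp2.
pose f : (V -> R) -> R := latent x U.
exists D1, D2, f, f, f; split=> //; first by split=> //; exists D1.
apply: box_not_null => v vb.
have f0 i : latent_factor x U true i (v i) != 0 by apply: factor_cell.
split.
- exact: (do_defined_latent xU aD1 rU1 rp1 Up1 xr1 (negbTE mp1)).
- exact: (do_defined_latent xU aD2 rU2 rp2 Up2 xr2 mp2).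
rewrite (do_marginal_latent xU aD1 rU1 rp1 Up1 xr1 (negbTE mp1) xX XU f0 yU yY).
rewrite (do_marginal_latent xU aD2 rU2 rp2 Up2 xr2 mp2 xX XU f0 yU yY).
by rewrite /= factor_cellx // => -[]; lra.
Qed.

End TwoOrientations.

(** * From the given path to two orientations *)

Theorem proposition3p2 (R : realType) (V : finType) (G : graph V)
    (X Y : {set V}) :
  is_mpdag G ->
  [disjoint X & Y] ->
  (exists x v p,
    [/\ path_from_to X Y x (v :: p),
        proper_path X (v :: p),
        possibly_causal_path G x (v :: p)
      & und G x v]) ->
  ~ identifiable R G X Y.
Proof.
move=> mG _ [x [v [p [/andP[xX lY] /allP pX /and3P[/andP[up pp] _ pw] uxv]]]].
have /split_last_has[p1 [z [p2 [e uxz nuz]]]] : has (und G x) (v :: p).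
  by rewrite /= uxv.
have pz : path (adj G) z p2.
  by move: pp; rewrite e cat_path => /andP[_ /= /andP[]].
have [q [sq lq pq cq]] := chordless_subpath pz.
have szq : subseq (z :: q) (v :: p).
  rewrite e -[z :: q]cat0s; apply: cat_subseq; first exact: sub0seq.
  by rewrite /= eqxx.
move: up pw => /andP[xvp uvp]; rewrite pairwise_cons => /andP[/allP xpw pw].
have uzq := subseq_uniq szq uvp.
have pwzq := subseq_pairwise szq pw.
have xzq : x \notin z :: q by apply: contra xvp; exact: mem_subseq.
(* Possible causality forbids [w -> x], and [x - z] is the last undirected edge from [x] to the
   path. *)
have xdir w : w \in q -> adj G x w -> dir G x w.
  move=> wq /or3P[//|wx|uxw].
    by have := xpw w (mem_subseq szq _); rewrite inE wq orbT wx => /(_ isT).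
  by case/negP: nuz; apply/hasP; exists w => //; exact: mem_subseq sq _ wq.
have lzq : last x (v :: p) = last z q by rewrite e last_cat /= lq.
have [D1 [rD1 xz1]] := und_orientable mG uxz.
have [D2 [rD2 zx2]] : exists D, represented G D /\ dir D z x.
  by apply: und_orientable mG _; rewrite und_sym.
have [r1 [r1q r1c r1p r1x]] := chordless_root rD1 uzq pq cq pwzq.
have [r2 [r2q r2c r2p _]] := chordless_root rD2 uzq pq cq pwzq.
have [[aD1 _] adj1 _ sub1] := rD1; have [[aD2 _] _ _ _] := rD2.
pose U := [set w in z :: q]%SET.
have UE w : (w \in U) = (w \in z :: q) by rewrite finset.inE.
apply: (@not_identifiable_two_orientations R V G D1 D2 X Y U x r1 r2 (last z q)
  rD1 rD2 xX); rewrite ?UE ?mem_last //.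
- move=> w wX; rewrite UE; apply: contraL wX => /(mem_subseq szq); exact: pX.
- by rewrite -lzq.
- move=> w; rewrite UE => /r1c c; apply/negP => /(pdag_acyclic aD1).
  by rewrite c.
- move=> w; rewrite UE => /r2c c; apply/negP => /(pdag_acyclic aD2).
  by rewrite c.
- move=> w; rewrite UE => wq /(r1p w wq)[u uq uw].
  by exists u => //; rewrite UE.
- move=> w; rewrite UE => wq /(r2p w wq)[u uq uw].
  by exists u => //; rewrite UE.
- exact: r1x.
(* The root [r2] reaches [z] and [z -> x], so [x -> r2] would close a cycle in [D2]. *)
- apply/negP => xr; have := pdag_acyclic aD2 xr.
  by rewrite (connect_trans (r2c z (mem_head _ _)) (connect1 zx2)).
(* In [D1] the node [z] is a child of [x], and so is every other neighbour of [x] in [U], already in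
   [G]. *)
- rewrite negb_exists; apply/forallP => w; rewrite negb_and -implybE.
  apply/implyP; rewrite UE in_parents inE => /orP[/eqP->|wq].
    by rewrite (dir_asym xz1).
  apply/negP => wx; have xw : dir D1 x w.
    by apply/sub1/xdir => //; rewrite -adj1; exact: dir_adjr.
  by rewrite (dir_asym xw) in wx.
- by apply/existsP; exists z; rewrite UE mem_head in_parents.
Qed.
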